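(* In the two-period model with a transparent bailout and $p_0<p_g<1-S$, suppose a short-lived stimulation equilibrium exists. Then in that equilibrium: (i) $\bar\theta_g<\bar\theta_m<p_g$; (ii) $\hat\theta<\theta_0<\hat\theta_g=p_g+S$; (iii) $p_g<2\theta_0-\mathbb{E}[\theta\mid\theta\le\theta_0]$.
   Context: Two-period model: a continuum of firms with privately known type $\theta\in[0,1]$, cdf $F$, density $f>0$, $f$ strictly log-concave, and for every $b\in(0,1]$ the map $a\mapsto 2\mathbb{E}[\theta\mid a<\theta<b]-\mathbb{E}[\theta\mid\theta\le a]$ is increasing on $(0,b)$. A type-$\theta$ firm holds one unit of an asset worth $\theta$ in each of two periods $t=1,2$. In each period it has a project with cost $I>0$ and net return $S>0$ that can be funded only by selling that period's unit; selling that unit at price $p\ge I$ yields $p+S$ for that period, not selling yields $\theta$. A firm's total payoff is the sum of the two periods' payoffs (period-2 payoff weighted by $\delta<1$, and equilibria are considered in the limit $\delta\to1$). In each period competitive short-lived risk-neutral buyers make price offers (Bertrand; break even in expectation; indifferent buyers buy). At $t=1$ only, the government offers to buy one unit at price $p_g$; each firm then sells its $t=1$ unit to the government, to the market, or not at all. Sales to the market at $t=1$ are not observed by $t=2$ buyers. Transparent bailout: acceptance of the government offer is observed by $t=2$ buyers, who may make different offers to bailout recipients and non-recipients. Equilibrium means perfect Bayesian equilibrium. Laissez-faire: $\theta_0\in(0,1)$ uniquely solves $\theta_0-S=\mathbb{E}[\theta\mid\theta\le\theta_0]$, $p_0:=\mathbb{E}[\theta\mid\theta\le\theta_0]$, and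 $p_0\ge I$. Equilibrium structure: every equilibrium has cutoffs $0<\hat\theta\le\hat\theta_g\le\theta_2$ such that types $\theta\le\hat\theta$ sell in both periods, types in $(\hat\theta,\hat\theta_g]$ sell only at $t=1$ to the government, types in $(\hat\theta_g,\theta_2]$ sell only at $t=2$, and types above $\theta_2$ never sell. Among types $\theta\le\hat\theta$, $\mu_g$ and $\mu_m=1-\mu_g$ denote the fractions selling at $t=1$ to the government and to the market, and $\bar\theta_g$, $\bar\theta_m$ the average asset values of these two groups. A short-lived stimulation equilibrium is an equilibrium with $\hat\theta_g=\theta_2$; a delayed stimulation equilibrium is one with $\hat\theta_g<\theta_2$. *)

(* Defs.v *)
From mathcomp Require Import all_boot all_order all_algebra.
From mathcomp Require Import all_classical all_reals all_analysis.
Import Order.TTheory GRing.Theory Num.Theory.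
Local Open Scope classical_set_scope.
Local Open Scope ring_scope.

Set Implicit Arguments.
Unset Strict Implicit.
Unset Printing Implicit Defensive.

Section Model.
Variable R : realType.

Definition leb : {measure set (measurableTypeR R) -> \bar R} := @lebesgue_measure R.

Definition intcc (a b : R) (g : R -> R) : R := Rintegral leb `[a, b] g.
Definition intoo (a b : R) (g : R -> R) : R := Rintegral leb `]a, b[ g.

Definition cexp_le (f : R -> R) (a : R) : R :=
  intcc 0 a (fun x => x * f x) / intcc 0 a f.
Definition cexp_oo (f : R -> R) (a b : R) : R :=
  intoo a b (fun x => x * f x) / intoo a b f.

Definition density_assumptions (f : R -> R) : Prop :=
  measurable_fun (`[0, 1] : set (measurableTypeR R)) f /\
  (forall x, 0 <= x <= 1 -> 0 < f x) /\
  intcc 0 1 f = 1 /\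
  (forall x y t, 0 <= x <= 1 -> 0 <= y <= 1 -> x != y -> 0 < t < 1 ->
     t * ln (f x) + (1 - t) * ln (f y) < ln (f (t * x + (1 - t) * y))) /\
  (forall b, 0 < b <= 1 -> forall a1 a2, 0 < a1 -> a1 < a2 -> a2 < b ->
     2 * cexp_oo f a1 b - cexp_le f a1 < 2 * cexp_oo f a2 b - cexp_le f a2).

(* payoff of selling one unit at price p: p + S if the project is funded
   (p >= I), otherwise just the cash p *)
Definition sale (I S p : R) : R := if I <= p then p + S else p.

(* period-1 actions: sell to the government, to the market, or not at all *)
Inductive act1 := AG | AM | AN.

(* A (mixed) firm strategy: sigma a s x = probability that type x takes
   period-1 action a and sells (s = true) or not (s = false) at t = 2. *)
Definition strategy := act1 -> bool -> R -> R.

Definition valid_strategy (sigma : strategy) : Prop :=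
  (forall a s x, 0 <= sigma a s x) /\
  (forall x, 0 <= x <= 1 ->
     sigma AG true x + sigma AG false x + sigma AM true x + sigma AM false x
     + sigma AN true x + sigma AN false x = 1) /\
  (forall a s, measurable_fun (`[0, 1] : set (measurableTypeR R)) (sigma a s)).

(* total payoff (delta -> 1, i.e. undiscounted sum) of type x playing (a, s)
   when the t=1 market price is p1, and t=2 prices are p2g (bailout recipients)
   and p2n (non-recipients) *)
Definition payoff (I S pg p1 p2g p2n : R) (x : R) (a : act1) (s : bool) : R :=
  let u1 := match a with AG => sale I S pg | AM => sale I S p1 | AN => x end in
  let p2 := match a with AG => p2g | _ => p2n end in
  u1 + (if s then sale I S p2 else x).

Definition ind (b : bool) : R := if b then 1 else 0.

Definition V2 (I S p x : R) : R := Num.max (sale I S p) x.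

(* Perfect Bayesian equilibrium with transparent bailout: firm strategy sigma,
   competitive (Bertrand) market prices p1 (t=1), p2g, p2n (t=2, for bailout
   recipients / non-recipients). *)
Definition equilibrium (f : R -> R) (I S pg : R) (sigma : strategy)
    (p1 p2g p2n : R) : Prop :=
  valid_strategy sigma /\
  (forall x, 0 <= x <= 1 -> forall a s, 0 < sigma a s x ->
     forall a' s', payoff I S pg p1 p2g p2n x a' s' <= payoff I S pg p1 p2g p2n x a s) /\
  (* buyers break even in each market *)
  intcc 0 1 (fun x => (x - p1) * (sigma AM true x + sigma AM false x) * f x) = 0 /\
  intcc 0 1 (fun x => (x - p2g) * sigma AG true x * f x) = 0 /\
  intcc 0 1 (fun x => (x - p2n) * (sigma AM true x + sigma AN true x) * f x) = 0 /\
  (* no buyer gains by outbidding at t=1 (t=2 prices unaffected) *)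
  (forall p, p1 < p ->
     intcc 0 1 (fun x => (x - p) *
       ind ((sale I S pg + V2 I S p2g x <= sale I S p + V2 I S p2n x) &&
        (x + V2 I S p2n x <= sale I S p + V2 I S p2n x)) * f x) <= 0) /\
  (* no buyer gains by outbidding at t=2 among bailout recipients *)
  (forall p, p2g < p ->
     intcc 0 1 (fun x => (x - p) * ind (x <= sale I S p) *
       (sigma AG true x + sigma AG false x) * f x) <= 0) /\
  (* no buyer gains by outbidding at t=2 among non-recipients *)
  (forall p, p2n < p ->
     intcc 0 1 (fun x => (x - p) * ind (x <= sale I S p) *
       (sigma AM true x + sigma AM false x + sigma AN true x + sigma AN false x)
       * f x) <= 0).

Definition cutoff_structure (sigma : strategy) (th thg th2 : R) : Prop :=
  0 < th /\ th <= thg /\ thg <= th2 /\ th2 <= 1 /\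
  {ae leb, forall x : measurableTypeR R, 0 <= x <= 1 ->
     [/\ x <= th -> sigma AG true x + sigma AM true x = 1,
         th < x <= thg -> sigma AG false x = 1,
         thg < x <= th2 -> sigma AN true x = 1 &
         th2 < x -> sigma AN false x = 1]}.

Definition avg_g (f : R -> R) (sigma : strategy) (th : R) : R :=
  intcc 0 th (fun x => x * sigma AG true x * f x) / intcc 0 th (fun x => sigma AG true x * f x).
Definition avg_m (f : R -> R) (sigma : strategy) (th : R) : R :=
  intcc 0 th (fun x => x * sigma AM true x * f x) / intcc 0 th (fun x => sigma AM true x * f x).

End Model.

(* Main.v *)
Require Import Defs.
From mathcomp Require Import all_boot all_order all_algebra.
From mathcomp Require Import all_classical all_reals all_analysis.
From mathcomp Require Import measurable_realfun ring lra.
Import Order.TTheory GRing.Theory Num.Theory.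
Local Open Scope ring_scope.

Set Implicit Arguments.
Unset Strict Implicit.
Unset Printing Implicit Defensive.

(* Log-concavity makes [x - E(theta | theta <= x)] nondecreasing, so it exceeds
   [S] strictly to the right of [theta_0].  Types just below [th] sell in period
   2 at a break-even price, so [th <= E(theta | theta <= th) + S], whence
   [th <= theta_0 < pg + S <= thg]: some types sell to the government only, and
   [thg = pg + S].  Neither the government group nor the market group can be
   null, for otherwise a period-2 buyer would have a profitable offer.  Hence
   types below [th] are indifferent between the two: with break-even prices equal
   to the group averages, [pg + avg_g = 2 avg_m] and [th = avg_g + S], while
   [avg_g < pg] because [th < thg].  The three claims follow by arithmetic, with
   [2 theta_0 - p_0 = theta_0 + S] for (iii). *)

(** * Integration on closed intervals: almost-everywhere arguments and translation *)

Section Integral.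
Local Open Scope classical_set_scope.
Variable R : realType.
Implicit Types (a b c d u v : R) (f g h : R -> R).

(** A nondegenerate interval is not null. This extracts an actual type from the almost-everywhere
    cutoff description, as optimality is a pointwise condition. *)
Lemma ae_itvoo_ex u v (P : R -> Prop) :
  u < v -> {ae leb R, forall x : measurableTypeR R, P x} ->
  exists2 x, u < x < v & P x.
Proof.
move=> uv [N [mN N0 subN]]; apply: contrapT => nex.
have subuv : `]u, v[ `<=` N.
  move=> x /=; rewrite in_itv/= => xuv; apply: subN => /= Px.
  by apply: nex; exists x.
have : (leb R `]u, v[%classic <= leb R N)%E.
  by apply: le_measure => //; rewrite inE.
rewrite N0 [leb _ _](lebesgue_measure_itv (`]u, v[%R)) /= lte_fin uv.
by rewrite -EFinB lee_fin; lra.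
Qed.

Lemma integrable_measurable a b g : (leb R).-integrable `[a, b] (EFin \o g) ->
  measurable_fun (`[a, b] : set (measurableTypeR R)) g.
Proof. by move=> ig; apply/measurable_EFinP; exact: measurable_int ig. Qed.

Lemma intcc_split a b c g : a <= b -> b <= c ->
  (leb R).-integrable `[a, c] (EFin \o g) ->
  intcc a c g = intcc a b g + intcc b c g.
Proof.
move=> ab bc ig; rewrite /intcc.
have := @Rintegral_itvB R g (BLeft a) (BRight c) b ig.
rewrite !bnd_simp => /(_ ab bc) e.
have -> : Rintegral (leb R) `[b, c] g = Rintegral (leb R) `]b, c] g.
  rewrite [RHS]Rintegral_itv_obnd_cbnd//.
  apply: integrableS ig => //.
  by apply: subset_itv; rewrite bnd_simp.
by rewrite -[X in _ + X]e; rewrite addrC subrK.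
Qed.

Lemma intcc_ae_eq a b g h :
  measurable_fun (`[a, b] : set (measurableTypeR R)) g ->
  measurable_fun (`[a, b] : set (measurableTypeR R)) h ->
  {ae leb R, forall x : measurableTypeR R, a <= x <= b -> g x = h x} ->
  intcc a b g = intcc a b h.
Proof.
move=> mg mh gh; congr fine; apply: ae_eq_integral => //.
- exact/measurable_EFinP.
- exact/measurable_EFinP.
- apply: filterS gh => x gh /=; rewrite in_itv/= => xab; congr EFin; exact: gh.
Qed.

Lemma intcc0 a b g : (forall x, a <= x <= b -> g x = 0) -> intcc a b g = 0.
Proof.
move=> g0; rewrite /intcc (@eq_Rintegral _ _ _ _ _ (cst 0)).
  by rewrite Rintegral_cst// mul0r.
by move=> x; rewrite inE/= in_itv/= => /g0.
Qed.

Lemma intcc_eq0_ae a b g :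
  (leb R).-integrable `[a, b] (EFin \o g) ->
  (forall x, a <= x <= b -> 0 <= g x) -> intcc a b g = 0 ->
  {ae leb R, forall x : measurableTypeR R, a <= x <= b -> g x = 0}.
Proof.
move=> ig g0 Ig0.
have mD : measurable (`[a, b] : set (measurableTypeR R)) by [].
have /ae_eq_integral_abs : measurable_fun
    (`[a, b] : set (measurableTypeR R)) (EFin \o g).
  exact: measurable_int ig.
move=> /(_ (leb R) mD)[+ _].
have -> : (\int[leb R]_(x in `[a, b]) `|(EFin \o g) x|)%E = 0%E.
  transitivity (\int[leb R]_(x in `[a, b]) (g x)%:E)%E.
    apply: eq_integral => x; rewrite inE/= in_itv/= => /g0 gx.
    by rewrite ger0_norm.
  rewrite -[LHS]fineK; last exact: integrable_fin_num.
  by congr EFin.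
move=> /(_ erefl); apply: filterS => x gx xab.
by have := gx; rewrite /= in_itv/= => /(_ xab)[].
Qed.

(** A zero integral would make [g] vanish almost everywhere, in particular at some point of []u,
    v[]. The sign condition is only almost everywhere because strategies are known only up to null
    sets. *)
Lemma intcc_gt0 a b u v g : a <= u -> u < v -> v <= b ->
  (leb R).-integrable `[a, b] (EFin \o g) ->
  {ae leb R, forall x : measurableTypeR R, a <= x <= b ->
    0 <= g x /\ (u < x < v -> 0 < g x)} ->
  0 < intcc a b g.
Proof.
move=> au uv vb ig g0.
have mg := integrable_measurable ig.
have ign : (leb R).-integrable `[a, b] (EFin \o (fun x => `|g x|)).
  exact: integrable_norm ig.
have -> : intcc a b g = intcc a b (fun x => `|g x|).
  apply: intcc_ae_eq => //; first exact: measurableT_comp.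
  by apply: filterS g0 => x H /H [/ger0_norm ->].
rewrite lt0r Rintegral_ge0// andbT; apply/eqP => I0.
have := intcc_eq0_ae ign (fun _ _ => normr_ge0 _) I0.
move=> {}I0; have [x] := ae_itvoo_ex uv (filterI g0 I0).
move=> /andP[ux xv] []; have xab : a <= x <= b by lra.
move=> /(_ xab) [_]; rewrite ux xv => /(_ isT) g1 /(_ xab)/eqP.
by rewrite normr_eq0 => /eqP; lra.
Qed.

(** The pushforward of Lebesgue measure under translation agrees with it on half-open intervals,
    hence everywhere. *)
Lemma integral_shift a d g :
  measurable_fun (`[0, a] : set (measurableTypeR R)) g ->
  (forall x, 0 <= x <= a -> 0 <= g x) ->
  (\int[leb R]_(x in `[d, (a + d)%R]) (g (x - d)%R)%:E =
  \int[leb R]_(x in `[0%R, a]) (g x)%:E)%E.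
Proof.
move=> mg g0.
pose phi : measurableTypeR R -> measurableTypeR R := fun x => x - d.
have mphi : measurable_fun setT phi by exact: measurable_funB.
have E : phi @^-1` `[0, a] = `[d, a + d]%classic.
  by apply/seteqP; split => x /=; rewrite !in_itv/= /phi => /andP[? ?]; apply/andP; split; lra.
rewrite -E.
have := @ge0_integral_pushforward _ _ _ _ R phi mphi (leb R) `[0, a]%classic (EFin \o g).
move=> <- //; last 2 first.
- exact/measurable_EFinP.
- by move=> x; rewrite inE/= in_itv/= lee_fin => /g0.
apply: eq_measure_integral => A mA _; apply/esym.
apply: (@lebesgue_measure_unique R (pushforward (leb R) phi)) => //= _ [[x y]] _ <-.
rewrite /pushforward.
have -> : phi @^-1` `]x, y] = `]x + d, y + d]%classic.
  by apply/seteqP; split => z /=; rewrite !in_itv/= /phi => /andP[? ?]; apply/andP; split; lra.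
rewrite [RHS](lebesgue_measure_itv `]x + d, y + d]%R) [LHS](lebesgue_measure_itv `]x, y]%R)/=.
rewrite !lte_fin ltrD2r.
by case: ifP => // _; rewrite -!EFinB; congr EFin; ring.
Qed.

Lemma integrable_lin a b p q g h :
  (leb R).-integrable `[a, b] (EFin \o g) ->
  (leb R).-integrable `[a, b] (EFin \o h) ->
  (leb R).-integrable `[a, b] (EFin \o (fun x => p * g x + q * h x)).
Proof.
move=> ig ih.
have mD : measurable (`[a, b] : set (measurableTypeR R)) by [].
have := integrableD mD (integrableZl mD p ig) (integrableZl mD q ih).
by apply: eq_integrable.
Qed.

Lemma intcc_lin a b p q g h :
  (leb R).-integrable `[a, b] (EFin \o g) ->
  (leb R).-integrable `[a, b] (EFin \o h) ->
  intcc a b (fun x => p * g x + q * h x) = p * intcc a b g + q * intcc a b h.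
Proof.
move=> ig ih.
have mD : measurable (`[a, b] : set (measurableTypeR R)) by [].
rewrite /intcc RintegralD//; last 2 first.
- by apply: eq_integrable (integrableZl mD p ig).
- by apply: eq_integrable (integrableZl mD q ih).
by rewrite !RintegralZl.
Qed.

Lemma integrable_bounded_mul a b M g h :
  measurable_fun (`[a, b] : set (measurableTypeR R)) g ->
  (forall x, a <= x <= b -> `|g x| <= M) ->
  (leb R).-integrable `[a, b] (EFin \o h) ->
  (leb R).-integrable `[a, b] (EFin \o (fun x => g x * h x)).
Proof.
move=> mg gM ih.
have mD : measurable (`[a, b] : set (measurableTypeR R)) by [].
apply: (le_integrable mD _ _ (integrableZl mD M ih)).
- apply/measurable_EFinP; apply: measurable_funM => //.
  exact: integrable_measurable ih.
- move=> x /=; rewrite in_itv/= => xab.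
  rewrite lee_fin !normrM ler_wpM2r//.
  by rewrite (le_trans (gM _ xab))// ler_norm.
Qed.

Lemma integrable_itv a b c d h : a <= c -> d <= b ->
  (leb R).-integrable `[a, b] (EFin \o h) ->
  (leb R).-integrable `[c, d] (EFin \o h).
Proof.
move=> ac db; apply: integrableS => //.
by apply: subset_itv; rewrite bnd_simp.
Qed.

Lemma integrable_idM a b h : (leb R).-integrable `[a, b] (EFin \o h) ->
  (leb R).-integrable `[a, b] (EFin \o (fun x => x * h x)).
Proof.
apply: (@integrable_bounded_mul _ _ (`|a| + `|b|)) => // x /andP[ax xb].
rewrite ler_norml; have := ler_norm b; have := ler_norm (- a).
by rewrite normrN; have := normr_ge0 a; have := normr_ge0 b => *; apply/andP; split; lra.
Qed.

Lemma intcc_shift a d g :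
  (leb R).-integrable `[0, a] (EFin \o g) ->
  (forall x, 0 <= x <= a -> 0 <= g x) ->
  (leb R).-integrable `[d, a + d] (EFin \o (fun x => g (x - d))) /\
  intcc d (a + d) (fun x => g (x - d)) = intcc 0 a g.
Proof.
move=> ig g0.
have mg := integrable_measurable ig.
have E := integral_shift d mg g0.
split; last by congr fine.
apply/integrableP; split.
- apply/measurable_EFinP.
  apply: (measurable_comp (F := `[0, a]%classic : set (measurableTypeR R))) => //.
    by move=> _ [x + <-] /=; rewrite !in_itv/= => /andP[? ?]; rewrite subr_ge0 lerBlDr; apply/andP.
  exact: measurable_funB.
- case/integrableP : ig => _; apply: le_lt_trans.
  rewrite (_ : (\int[leb R]_(x in `[0%R, a]) _)%E =
    (\int[leb R]_(x in `[0%R, a]) (g x)%:E)%E); last first.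
    by apply: eq_integral => x; rewrite inE/= in_itv/= => /g0 /ger0_norm ->.
  rewrite -E le_eqVlt; apply/orP; left; apply/eqP.
  apply: eq_integral => x; rewrite inE/= in_itv/= => xd.
  by rewrite ger0_norm//; apply: g0; lra.
Qed.

End Integral.

(** * Log-concave densities and truncated means *)

Section Density.
Local Open Scope classical_set_scope.
Variable R : realType.
Variable f : R -> R.
Hypothesis f_gt0 : forall x, 0 <= x <= 1 -> 0 < f x.

(** The real-valued integral sends an infinite value to 0, so its being 1 already forces
    finiteness. *)
Lemma density_integrable :
  measurable_fun (`[0, 1] : set (measurableTypeR R)) f -> intcc 0 1 f = 1 ->
  (leb R).-integrable `[0, 1] (EFin \o f).
Proof.
move=> mf f1; apply/integrableP; split; first exact/measurable_EFinP.
rewrite (_ : (\int[leb R]_(x in _) _)%E =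
    (\int[leb R]_(x in `[0%R, 1%R]) (f x)%:E)%E); last first.
  by apply: eq_integral => x; rewrite inE/= in_itv/= => /f_gt0 /gtr0_norm ->.
move: f1; rewrite /intcc /Rintegral.
case: integral => [r|//|]/=; rewrite ?ltry//.
by move=> /eqP; rewrite eq_sym oner_eq0.
Qed.

Hypothesis fi : (leb R).-integrable `[0, 1] (EFin \o f).

Lemma intcc_density_gt0 b : 0 < b <= 1 -> 0 < intcc 0 b f.
Proof.
move=> /andP[b0 b1]; apply: (intcc_gt0 (lexx 0) b0 (lexx b)).
  exact: integrable_itv fi.
apply: aeW => x xb; have : 0 < f x by apply: f_gt0; lra.
by move=> fx; split => // ; exact: ltW.
Qed.

Hypothesis f_logconcave : forall x y t, 0 <= x <= 1 -> 0 <= y <= 1 -> x != y ->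
  0 < t < 1 -> t * ln (f x) + (1 - t) * ln (f y) < ln (f (t * x + (1 - t) * y)).

(** The points [x - d] and [y] are the convex combinations of [y - d] and [x] with mirrored weights
    [t] and [1 - t]; adding the two log-concavity inequalities makes the weights cancel. *)
Lemma logconcave_mlr d y x : 0 < d -> d <= y -> y < x -> x <= 1 ->
  f (y - d) * f x <= f (x - d) * f y.
Proof.
move=> d0 dy yx x1.
have P z : 0 <= z <= 1 -> f z \is Num.pos by rewrite posrE; exact: f_gt0.
have D : 0 < x - y + d by lra.
pose t := d / (x - y + d).
have t01 : 0 < t < 1.
  by rewrite divr_gt0//= /t ltr_pdivrMr// mul1r; lra.
have tD : t * (x - y + d) = d by rewrite /t divfK// gt_eqF.
have ne : y - d != x by rewrite lt_eqF//; lra.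
have l1 := f_logconcave (x := y - d) (y := x) (t := t) ltac:(lra) ltac:(lra) ne t01.
have l2 := f_logconcave (x := x) (y := y - d) (t := t) ltac:(lra) ltac:(lra)
  ltac:(by rewrite eq_sym) t01.
have e1 : t * (y - d) + (1 - t) * x = x - d.
  by transitivity (x - t * (x - y + d)); [ring|rewrite tD].
have e2 : t * x + (1 - t) * (y - d) = y.
  by transitivity (t * (x - y + d) + (y - d)); [ring|rewrite tD; ring].
rewrite e1 in l1; rewrite e2 in l2.
rewrite -ler_ln ?posrE ?mulr_gt0 ?f_gt0//; try lra.
by rewrite !lnM ?P//; lra.
Qed.

(* [c] is where the shifted density overtakes [k] times the original one; the
   likelihood ratio is monotone by [logconcave_mlr]. *)
Lemma crossing d b (k : R) : 0 < d -> d < b -> b <= 1 ->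
  exists2 c, d <= c & forall x, d <= x <= b ->
    0 <= (x - c) * (f (x - d) - k * f x).
Proof.
move=> d0 db b1.
(* The point [d] is put in by hand, so that the set is nonempty and its supremum is at least [d]
   even if the strict inequality never occurs. *)
pose A := [set x | d <= x <= b /\ (x = d \/ f (x - d) < k * f x)].
have Ad : A d by split; [lra|left].
have supA : has_sup A.
  by split; [exists d|exists b => x [/andP[]]].
have dc : d <= sup A by apply: ub_le_sup => //; case: supA.
exists (sup A) => // x /andP[dx xb].
have [xc|cx|->] := ltgtP x (sup A); last by rewrite subrr mul0r.
(* Some later [y] of the set still satisfies the strict inequality, and the monotone likelihood
   ratio carries it back to [x]. *)
- have [y [/andP[dy yb] Ay] xy] : exists2 y, A y & x < y.
    have := sup_adherent (eps := sup A - x) ltac:(lra) supA => -[y Ay].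
    by rewrite subKr => ?; exists y.
  case: Ay => [yd|Ay]; first lra.
  have fx : 0 < f x by apply: f_gt0; lra.
  have fy : 0 < f y by apply: f_gt0; lra.
  have mlr := logconcave_mlr d0 dx xy ltac:(lra).
  have : f (x - d) * f y < k * f x * f y.
    apply: le_lt_trans mlr _; rewrite -mulrA (mulrC (f x)) mulrA ltr_pM2r//.
  by rewrite ltr_pM2r// => ?; nra.
- suff : k * f x <= f (x - d) by nra.
  rewrite leNgt; apply/negP => Ax.
  have : x <= sup A by apply: ub_le_sup; [case: supA|split; [lra|right]].
  lra.
Qed.

(* The law of theta given [theta <= a], shifted by [d = b - a], dominates the law
   given [theta <= b] in likelihood ratio; integrating the single-crossing
   inequality against [x - c] compares the means. *)
Lemma sub_cexp_le_homo a b : 0 < a -> a < b -> b <= 1 ->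
  a - cexp_le f a <= b - cexp_le f b.
Proof.
move=> a0 ab b1.
pose d := b - a.
have d0 : 0 < d by rewrite /d; lra.
have ad : a + d = b by rewrite /d; ring.
have db : d < b by lra.
have fi0 e : e <= 1 -> (leb R).-integrable `[0, e] (EFin \o f).
  by move=> e1; apply: integrable_itv fi.
have fid : (leb R).-integrable `[d, b] (EFin \o f).
  by apply: integrable_itv fi => //; lra.
set G := intcc 0 a f; set H := intcc 0 b f.
have G0 : 0 < G by apply: intcc_density_gt0; lra.
have H0 : 0 < H by apply: intcc_density_gt0; lra.
have [c dc cP] := crossing (G / H) d0 db b1.
have fge x : 0 <= x <= a -> 0 <= f x by move=> ?; apply/ltW/f_gt0; lra.
have [ig1] := intcc_shift d (fi0 a ltac:(lra)) fge.
rewrite -/G ad in ig1 * => Eg1.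
(* Shifting [h] by [d] gives [x * f (x - d)], the integrand of the first moment of the shifted
   density. *)
pose h x := 1 * (x * f x) + d * f x.
have ih : (leb R).-integrable `[0, a] (EFin \o h).
  apply: integrable_lin; last by apply: fi0; lra.
  by apply: integrable_idM; apply: fi0; lra.
have hge x : 0 <= x <= a -> 0 <= h x.
  by move=> xa; have := fge _ xa; rewrite /h; nra.
have [_] := intcc_shift d ih hge.
have -> : intcc 0 a h = 1 * intcc 0 a (fun x => x * f x) + d * G.
  by rewrite intcc_lin ?integrable_idM ?fi0//; lra.
rewrite ad (_ : intcc d b _ = intcc d b (fun x => x * f (x - d))); last first.
  by apply: eq_Rintegral => x _; rewrite /h; ring.
move=> Eg2.
(* [I1] and [I2] together integrate the single-crossing inequality over [[0, b]]: below [d] the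
   shifted density is zero, and [x <= d <= c] gives the sign. *)
have I1 : 0 <= intcc d b (fun x => (x - c) * (f (x - d) - G / H * f x)).
  by apply: Rintegral_ge0 => x /=; rewrite in_itv/=; exact: cP.
have I2 : 0 <= intcc 0 d (fun x => (- (G / H)) * (x * f x) + G / H * c * f x).
  apply: Rintegral_ge0 => x /=; rewrite in_itv/= => xd.
  have fx : 0 < f x by apply: f_gt0; lra.
  have : 0 <= G / H * ((c - x) * f x).
    apply: mulr_ge0; first by rewrite divr_ge0// ltW.
    by apply: mulr_ge0; [lra|exact: ltW].
  lra.
rewrite intcc_lin ?integrable_idM ?fi0// in I2; try lra.
have E1 : intcc d b (fun x => (x - c) * (f (x - d) - G / H * f x)) =
    intcc d b (fun x => 1 * (1 * (x * f (x - d)) + (- c) * f (x - d)) +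
      (- (G / H)) * (1 * (x * f x) + (- c) * f x)).
  by apply: eq_Rintegral => x _; ring.
rewrite E1 intcc_lin ?integrable_lin ?integrable_idM// in I1.
rewrite !intcc_lin ?integrable_idM// Eg1 Eg2 in I1.
have Hs := intcc_split (ltW d0) (ltW db) (fi0 b b1).
have Xs := intcc_split (ltW d0) (ltW db) (integrable_idM (fi0 b b1)).
rewrite /cexp_le -/G -/H.
set X := intcc 0 a _ in I1 *; set Y := intcc 0 b _ in Xs *.
suff : Y / H <= X / G + d by rewrite /d; lra.
rewrite -(ler_pM2l G0) mulrDr (mulrC G (X / G)) divfK ?gt_eqF//.
(* The factor [G / H] equalizes the two masses, so the terms in the unknown crossing point [c]
   cancel. *)
have cH : G / H * c * H = G * c by rewrite mulrAC divfK ?gt_eqF.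
have -> : G * (Y / H) = G / H * Y by ring.
rewrite -/H in Hs.
move: I1 I2 cH; rewrite Hs Xs.
set k := G / _ => I1 I2 cH; nra.
Qed.

(** Monotonicity is only weak; strictness comes from the midpoint of [th0] and [x], which is below 1
    even if [x = 1], so that uniqueness of [th0] excludes equality there. *)
Lemma cexp_le_lt_sub S th0 x : 0 < th0 -> th0 - S = cexp_le f th0 ->
  (forall x, 0 < x < 1 -> x - S = cexp_le f x -> x = th0) ->
  th0 < x -> x <= 1 -> cexp_le f x < x - S.
Proof.
move=> th0_gt0 e uniq th0x x1.
pose y := (th0 + x) / 2.
have thy : th0 < y by rewrite /y; lra.
have yx : y < x by rewrite /y; lra.
have h1 := sub_cexp_le_homo th0_gt0 thy ltac:(lra).
have h2 := sub_cexp_le_homo (lt_trans th0_gt0 thy) yx x1.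
have : y - S != cexp_le f y.
  have y01 : 0 < y < 1 by lra.
  by apply/eqP => /(uniq _ y01) ey; move: thy; rewrite ey ltxx.
by rewrite neq_lt => /orP[]; lra.
Qed.

End Density.

(** * Masses and means of groups of sellers *)

Section Groups.
Local Open Scope classical_set_scope.
Variable R : realType.
Variable f : R -> R.
Hypothesis f_gt0 : forall x, 0 <= x <= 1 -> 0 < f x.
Hypothesis fi : (leb R).-integrable `[0, 1] (EFin \o f).

Definition unit_valued (q : R -> R) : Prop :=
  measurable_fun (`[0, 1] : set (measurableTypeR R)) q /\
  forall x, 0 <= x <= 1 -> 0 <= q x <= 1.

Lemma integrable_unit_valued (q : R -> R) b : unit_valued q -> b <= 1 ->
  (leb R).-integrable `[0, b] (EFin \o (fun x => q x * f x)).
Proof.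
move=> [mq q01] b1; apply: (@integrable_itv _ 0 1 0 b) => //.
apply: (@integrable_bounded_mul _ _ _ 1) => // x /q01/andP[? ?].
by rewrite ger0_norm.
Qed.

Lemma ae_neq (c : R) : {ae leb R, forall x : measurableTypeR R, x != c}.
Proof.
exists [set c]; split => //; first exact: lebesgue_measure_set1.
by move=> x /= /negP; rewrite negbK => /eqP.
Qed.

(** Here [q] is the whole supply in a market and [r] its part from types up to [th]. The conclusion
    avoids division, so it also covers a null group. *)
Lemma break_even_mean (q r : R -> R) (p th : R) : unit_valued q -> unit_valued r ->
  0 < th <= 1 ->
  {ae leb R, forall x : measurableTypeR R, 0 <= x <= 1 ->
    (x <= th -> q x = r x) /\ (th < x -> q x = 0)} ->
  intcc 0 1 (fun x => (x - p) * q x * f x) = 0 ->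
  intcc 0 th (fun x => x * r x * f x) = p * intcc 0 th (fun x => r x * f x).
Proof.
move=> uq ur /andP[th0 th1] qr.
have iq := integrable_unit_valued uq (lexx 1).
have ir := integrable_unit_valued ur th1.
rewrite (_ : intcc 0 1 _ =
  intcc 0 1 (fun x => 1 * (x * (q x * f x)) + (- p) * (q x * f x))); last first.
  by apply: eq_Rintegral => x _; ring.
have iL (s : R -> R) b : (leb R).-integrable `[0, b] (EFin \o (fun x => s x * f x)) ->
   (leb R).-integrable `[0, b]
      (EFin \o (fun x => 1 * (x * (s x * f x)) + (- p) * (s x * f x))).
  by move=> ?; apply: integrable_lin => //; exact: integrable_idM.
rewrite (intcc_split (ltW th0) th1 (iL _ _ iq)).
(* The endpoint [th] belongs to this interval although [q] need not vanish there; it is discarded as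
   a null set. *)
rewrite [X in _ + X = _](_ : _ = 0); last first.
  rewrite -(@intcc0 R th 1 (cst 0))//; apply: intcc_ae_eq => //.
    apply: integrable_measurable; apply: (@integrable_itv _ 0 1 th 1 _ (ltW th0) (lexx 1)).
    exact: iL.
  apply: filterS (filterI qr (ae_neq th)) => x [xqr xth] /andP[thx x1].
  have x01 : 0 <= x <= 1 by rewrite x1 andbT (le_trans (ltW th0)).
  have thx' : th < x by rewrite lt_neqAle eq_sym xth.
  by rewrite (xqr x01).2// !(mul0r, mulr0) addr0.
rewrite addr0 => E.
have : intcc 0 th (fun x => 1 * (x * (r x * f x)) + (- p) * (r x * f x)) = 0.
  rewrite -[RHS]E; apply: intcc_ae_eq.
  - by apply: integrable_measurable; apply: iL; exact: integrable_unit_valued.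
  - by apply: integrable_measurable; apply: iL; exact: integrable_unit_valued.
  - move: qr; apply: filterS => x xqr /andP[x0 xth].
    have x01 : 0 <= x <= 1 by rewrite x0 (le_trans xth).
    by rewrite (xqr x01).1.
rewrite intcc_lin ?integrable_idM// => E2.
rewrite (_ : intcc 0 th (fun x => x * r x * f x) = intcc 0 th (fun x => x * (r x * f x))).
  lra.
by apply: eq_Rintegral => x _; ring.
Qed.

Lemma group_null (r : R -> R) (th : R) : unit_valued r -> th <= 1 ->
  intcc 0 th (fun x => r x * f x) = 0 ->
  {ae leb R, forall x : measurableTypeR R, 0 <= x <= th -> r x = 0}.
Proof.
move=> ur th1 W0.
have := intcc_eq0_ae (integrable_unit_valued ur th1) _ W0.
have xf (x : R) : 0 <= x <= th -> 0 <= r x /\ 0 < f x.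
  move=> /andP[x0 xth]; have x01 : 0 <= x <= 1 by rewrite x0 (le_trans xth).
  by split; [case: ur => _ /(_ x x01)/andP[]|exact: f_gt0].
move=> H; have {}H := H (fun x xt => mulr_ge0 (xf x xt).1 (ltW (xf x xt).2)).
apply: filterS H => x H xt; have [_ fx] := xf x xt.
by have /eqP := H xt; rewrite mulf_eq0 (gt_eqF fx) orbF => /eqP.
Qed.

Lemma group_ge0 (r : R -> R) (th : R) : unit_valued r -> th <= 1 ->
  0 <= intcc 0 th (fun x => r x * f x).
Proof.
move=> [_ r01] th1; apply: Rintegral_ge0 => x /=; rewrite in_itv/= => /andP[x0 xth].
have x01 : 0 <= x <= 1 by rewrite x0 (le_trans xth).
by rewrite mulr_ge0//; [case/andP: (r01 x x01)|exact/ltW/f_gt0].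
Qed.

Lemma group_inhabited (r : R -> R) (th : R) : unit_valued r -> th <= 1 ->
  0 < intcc 0 th (fun x => r x * f x) -> exists2 x, 0 <= x <= 1 & 0 < r x.
Proof.
move=> [_ r01] th1 W0; apply: contrapT => nex.
suff W : intcc 0 th (fun x => r x * f x) = 0 by rewrite W ltxx in W0.
apply: intcc0 => x /andP[x0 xth].
have x01 : 0 <= x <= 1 by rewrite x0 (le_trans xth).
have [rx|] := leP (r x) 0; last by move=> rx; case: nex; exists x.
suff -> : r x = 0 by rewrite mul0r.
by apply/le_anti; rewrite rx; case/andP: (r01 x x01).
Qed.

(** All members are worth at most [th]; equality of the mean would concentrate the group on the
    single point [th], which has no mass. *)
Lemma group_mean_lt (r : R -> R) (th : R) : unit_valued r -> 0 < th <= 1 ->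
  0 < intcc 0 th (fun x => r x * f x) ->
  intcc 0 th (fun x => x * r x * f x) < th * intcc 0 th (fun x => r x * f x).
Proof.
move=> ur /andP[th0 th1] W0.
have ir := integrable_unit_valued ur th1.
pose D := intcc 0 th (fun x => th * (r x * f x) + (-1) * (x * (r x * f x))).
have DE : D = th * intcc 0 th (fun x => r x * f x) - intcc 0 th (fun x => x * r x * f x).
  rewrite /D intcc_lin ?integrable_idM// mulN1r; congr (_ - _).
  by apply: eq_Rintegral => x _; ring.
rewrite -subr_gt0 -DE.
have D_ge0 (x : R) : 0 <= x <= th -> 0 <= th * (r x * f x) + (-1) * (x * (r x * f x)).
  move=> /andP[x0 xth]; have x01 : 0 <= x <= 1 by rewrite x0 (le_trans xth).
  rewrite mulN1r -mulrBl mulr_ge0 ?subr_ge0// mulr_ge0//.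
    by case: ur => _ /(_ x x01)/andP[].
  exact/ltW/f_gt0.
rewrite lt0r; apply/andP; split; last first.
  by apply: Rintegral_ge0 => x /=; rewrite in_itv/=; exact: D_ge0.
apply/eqP => D0.
have iD : (leb R).-integrable `[0, th]
    (EFin \o (fun x => th * (r x * f x) + (-1) * (x * (r x * f x)))).
  by apply: integrable_lin => //; exact: integrable_idM.
have DE0 := intcc_eq0_ae iD D_ge0 D0.
have : intcc 0 th (fun x => r x * f x) = intcc 0 th (cst 0).
  apply: intcc_ae_eq => //; first exact: integrable_measurable ir.
  apply: filterS (filterI DE0 (ae_neq th)) => x [H xth] xt; have /eqP := H xt.
  by rewrite mulN1r -mulrBl mulf_eq0 subr_eq0 eq_sym (negbTE xth) => /eqP.
by rewrite (intcc0 (g := cst 0))// => W; rewrite W ltxx in W0.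
Qed.

Lemma group_decomposition (r s : R -> R) (th : R) : unit_valued r -> unit_valued s ->
  th <= 1 ->
  {ae leb R, forall x : measurableTypeR R, 0 <= x <= th -> r x + s x = 1} ->
  intcc 0 th (fun x => r x * f x) + intcc 0 th (fun x => s x * f x) = intcc 0 th f /\
  intcc 0 th (fun x => x * r x * f x) + intcc 0 th (fun x => x * s x * f x) =
    intcc 0 th (fun x => x * f x).
Proof.
move=> ur us th1 rs.
have ir := integrable_unit_valued ur th1.
have is_ := integrable_unit_valued us th1.
have ift : (leb R).-integrable `[0, th] (EFin \o f).
  exact: (@integrable_itv R 0 1 0 th).
split.
  transitivity (intcc 0 th (fun x => 1 * (r x * f x) + 1 * (s x * f x))).
    by rewrite intcc_lin// !mul1r.
  apply: intcc_ae_eq; [|exact: integrable_measurable|].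
    by apply: integrable_measurable; exact: integrable_lin.
  apply: filterS rs => x rs xth.
  by rewrite !mul1r -mulrDl rs// mul1r.
transitivity (intcc 0 th (fun x => 1 * (x * (r x * f x)) + 1 * (x * (s x * f x)))).
  rewrite intcc_lin ?integrable_idM// !mul1r.
  by congr (_ + _); apply: eq_Rintegral => x _; rewrite mulrA.
apply: intcc_ae_eq; [|by apply: integrable_measurable; exact: integrable_idM|].
  by apply: integrable_measurable; apply: integrable_lin; exact: integrable_idM.
apply: filterS rs => x rs xth.
by rewrite !mul1r -mulrDr -mulrDl rs// mul1r.
Qed.

(* [q] is the mass of the sellers' information set; since it vanishes up to [u],
   an offer just below [u] that [u] strictly accepts only attracts types worth
   more than the price. *)
Lemma profitable_offer (q : R -> R) (I S p u v : R) : unit_valued q ->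
  0 < S -> I <= p -> p < u -> u < p + S -> 0 <= u -> u < v -> v <= 1 ->
  {ae leb R, forall x : measurableTypeR R, 0 <= x <= 1 ->
    (x <= u -> q x = 0) /\ (u < x < v -> q x = 1)} ->
  0 < intcc 0 1 (fun x => (x - p) * ind R (x <= sale I S p) * q x * f x).
Proof.
move=> [mq q01] S0 Ip pu up u0 uv v1 qu.
have saleE : sale I S p = p + S by rewrite /sale Ip.
(* Types between [u] and this minimum belong to the group, accept the offer and are worth more than
   [p]; they make the gain strict. *)
have uw : u < Num.min v (p + S) by rewrite lt_min uv.
have wv : Num.min v (p + S) <= 1 by rewrite ge_min v1.
apply: (intcc_gt0 u0 uw wv).
  apply: (@integrable_bounded_mul _ 0 1 (1 + `|p|)) fi.
    apply: measurable_funM => //; apply: measurable_funM.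
      exact: measurable_funB.
    apply: (measurable_fun_if) => //.
      by apply: measurable_fun_ler.
  move=> x x01; have /andP[q0 q1] := q01 x x01; rewrite !normrM.
  have -> : `|ind R (x <= sale I S p)| = ind R (x <= sale I S p).
    by rewrite /ind; case: ifP; rewrite ?normr0 ?normr1.
  rewrite (ger0_norm q0).
  have xp : `|x - p| <= 1 + `|p|.
    by rewrite (le_trans (ler_normB _ _))// lerD2r ger0_norm; case/andP: x01.
  have i1 : 0 <= ind R (x <= sale I S p) <= 1 by rewrite /ind; case: ifP; rewrite lexx ler01.
  case/andP: i1 => i0 i1.
  rewrite -[leRHS]mulr1 ler_pM ?mulr_ge0//.
  by rewrite -[leRHS]mulr1 ler_pM.
apply: filterS qu => x H x01; have [qle qin] := H x01.
have fx := f_gt0 x01; have /andP[q0 q1] := q01 x x01.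
split.
  have [xu|ux] := leP x u; first by rewrite (qle xu) mulr0 mul0r.
  rewrite !mulr_ge0 ?(ltW fx)//.
    by rewrite subr_ge0 ltW// (lt_trans pu).
  by rewrite /ind; case: ifP.
move=> /andP[ux]; rewrite lt_min => /andP[xv xS].
rewrite qin ?ux ?xv// saleE /ind (ltW xS) !mulr1 mulr_gt0//.
by rewrite subr_gt0 (lt_trans pu).
Qed.

End Groups.

(** * Firms' actions and the deviations they reject *)

Section Firms.
Local Open Scope classical_set_scope.
Variable R : realType.
Variables (I S pg p1 p2g p2n : R) (sigma : strategy R).

Lemma sale_le p : 0 < S -> sale I S p <= p + S.
Proof. by move=> S0; rewrite /sale; case: ifP => _; lra. Qed.

Lemma sale_gt p : p < sale I S p -> I <= p /\ sale I S p = p + S.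
Proof. by rewrite /sale; case: ifP => // _; rewrite ltxx. Qed.

Lemma unit_valued_acts : valid_strategy sigma ->
  [/\ unit_valued (sigma AG true), unit_valued (sigma AM true),
      unit_valued (fun x => sigma AG true x + sigma AG false x),
      unit_valued (fun x => sigma AM true x + sigma AM false x) &
      unit_valued (fun x => sigma AM true x + sigma AN true x)] /\
  unit_valued (fun x => sigma AM true x + sigma AM false x + sigma AN true x
    + sigma AN false x).
Proof.
move=> [s_ge0 [s_sum s_meas]].
have s01 x : 0 <= x <= 1 -> [/\ 0 <= sigma AG true x <= 1, 0 <= sigma AM true x <= 1,
    0 <= sigma AG true x + sigma AG false x <= 1,
    0 <= sigma AM true x + sigma AM false x <= 1 &
    0 <= sigma AM true x + sigma AN true x <= 1] /\
    0 <= sigma AM true x + sigma AM false x + sigma AN true x + sigma AN false x <= 1.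
  move=> xx; have := s_sum x xx.
  have := s_ge0 AG true x; have := s_ge0 AG false x; have := s_ge0 AM true x.
  have := s_ge0 AM false x; have := s_ge0 AN true x; have := s_ge0 AN false x.
  by clear => *; split; [split|]; lra.
split; last by split=> [|x /s01[]//]; do 3![apply: measurable_funD => //].
split.
- by split=> // x /s01[[]].
- by split=> // x /s01[[]].
- by split=> [|x /s01[[]]//]; exact: measurable_funD.
- by split=> [|x /s01[[]]//]; exact: measurable_funD.
- by split=> [|x /s01[[]]//]; exact: measurable_funD.
Qed.

(** The six probabilities are nonnegative and sum to 1, so the actions that the cutoffs prescribe
    exclude all others; with [thg] as both upper cutoffs, nobody sells only at [t = 2]. *)
Lemma short_lived_acts th thg : valid_strategy sigma ->
  cutoff_structure sigma th thg thg ->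
  {ae leb R, forall x : measurableTypeR R, 0 <= x <= 1 ->
    [/\ x <= th -> [/\ sigma AG true x + sigma AM true x = 1, sigma AG false x = 0,
          sigma AM false x = 0, sigma AN true x = 0 & sigma AN false x = 0],
        th < x -> [/\ sigma AG true x = 0, sigma AM true x = 0,
          sigma AM false x = 0 & sigma AN true x = 0],
        th < x <= thg -> sigma AG false x = 1 /\ sigma AN false x = 0 &
        thg < x -> sigma AG false x = 0 /\ sigma AN false x = 1]}.
Proof.
move=> [s_ge0 [s_sum _]] [_ [_ [_ [_ cut]]]].
suff acts (x : R) : 0 <= x <= 1 ->
    [/\ x <= th -> sigma AG true x + sigma AM true x = 1,
        th < x <= thg -> sigma AG false x = 1,
        thg < x <= thg -> sigma AN true x = 1 &
        thg < x -> sigma AN false x = 1] ->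
    [/\ x <= th -> [/\ sigma AG true x + sigma AM true x = 1, sigma AG false x = 0,
          sigma AM false x = 0, sigma AN true x = 0 & sigma AN false x = 0],
        th < x -> [/\ sigma AG true x = 0, sigma AM true x = 0,
          sigma AM false x = 0 & sigma AN true x = 0],
        th < x <= thg -> sigma AG false x = 1 /\ sigma AN false x = 0 &
        thg < x -> sigma AG false x = 0 /\ sigma AN false x = 1].
  by apply: filterS cut => x cx x01; apply: acts => //; exact: cx.
move=> x01 [c1 c2 _ c3]; have := s_sum x x01.
have := s_ge0 AG true x; have := s_ge0 AG false x; have := s_ge0 AM true x.
have := s_ge0 AM false x; have := s_ge0 AN true x; have := s_ge0 AN false x.
move=> {s_ge0 s_sum x01} g1 g2 g3 g4 g5 g6 gs; split=> [/c1 e|xth|/c2 e|/c3 e].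
- by clear -g1 g2 g3 g4 g5 g6 gs e; split; lra.
- have [/c3 e|xthg] := ltP thg x; first by clear -g1 g2 g3 g4 g5 g6 gs e; split; lra.
  have {}xth : th < x <= thg by rewrite xth.
  by have e := c2 xth; clear -g1 g2 g3 g4 g5 g6 gs e; split; lra.
- by clear -g1 g2 g3 g4 g5 g6 gs e; split; lra.
- by clear -g1 g2 g3 g4 g5 g6 gs e; split; lra.
Qed.

Hypothesis opt : forall x, 0 <= x <= 1 -> forall a s, 0 < sigma a s x ->
  forall a' s', payoff I S pg p1 p2g p2n x a' s' <= payoff I S pg p1 p2g p2n x a s.

Lemma optimal_AG_sell x : 0 <= x <= 1 -> 0 < sigma AG true x ->
  [/\ x <= sale I S p2g,
      sale I S p1 + sale I S p2n <= sale I S pg + sale I S p2g &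
      sale I S p1 + x <= sale I S pg + sale I S p2g].
Proof.
move=> x01 /(opt x01) o; have := o AG false; have := o AM true; have := o AM false.
by rewrite /payoff; clear => *; split; lra.
Qed.

Lemma optimal_AM_sell x : 0 <= x <= 1 -> 0 < sigma AM true x ->
  [/\ x <= sale I S p2n,
      sale I S pg + sale I S p2g <= sale I S p1 + sale I S p2n &
      sale I S pg + x <= sale I S p1 + sale I S p2n].
Proof.
move=> x01 /(opt x01) o; have := o AG false; have := o AG true; have := o AM false.
by rewrite /payoff; clear => *; split; lra.
Qed.

Lemma optimal_AG_keep x : 0 <= x <= 1 -> 0 < sigma AG false x ->
  sale I S p2g <= x /\ x <= sale I S pg.
Proof.
move=> x01 /(opt x01) o; have := o AG true; have := o AN false.
by rewrite /payoff; clear => *; split; lra.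
Qed.

Lemma optimal_AN_keep x : 0 <= x <= 1 -> 0 < sigma AN false x ->
  sale I S p2n <= x /\ sale I S pg <= x.
Proof.
move=> x01 /(opt x01) o; have := o AN true; have := o AG false.
by rewrite /payoff; clear => *; split; lra.
Qed.

End Firms.

(** * Equilibrium analysis *)

Theorem theorem3 (R : realType) (f : R -> R) (I S pg th0 : R)
  (sigma : strategy R) (p1 p2g p2n th thg th2 : R) :
  density_assumptions f ->
  0 < I -> 0 < S ->
  (* laissez-faire cutoff theta_0: unique solution in (0,1) *)
  0 < th0 < 1 -> th0 - S = cexp_le f th0 ->
  (forall x, 0 < x < 1 -> x - S = cexp_le f x -> x = th0) ->
  I <= cexp_le f th0 ->
  (* p_0 < p_g < 1 - S *)
  cexp_le f th0 < pg -> pg < 1 - S ->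
  (* a short-lived stimulation equilibrium *)
  equilibrium f I S pg sigma p1 p2g p2n ->
  cutoff_structure sigma th thg th2 -> thg = th2 ->
  [/\ avg_g f sigma th < avg_m f sigma th /\ avg_m f sigma th < pg,
      th < th0 /\ th0 < thg /\ thg = pg + S &
      pg < 2 * th0 - cexp_le f th0].
Proof.
move=> [mf [f_gt0 [f1 [flc _]]]] I0 S0 /andP[th0_gt0 th0_lt1] eth0 uniq Ip0 p0pg pgS
  [val [opt [be1 [be2g [be2n [_ [devg devn]]]]]]] cs thgE; subst th2.
have fi := density_integrable f_gt0 mf f1.
have [[ug um ugA umA umT] uN] := unit_valued_acts val.
have acts := short_lived_acts val cs.
case: cs => th_gt0 [th_thg [_ [thg1 _]]].
have th1 : th <= 1 := le_trans th_thg thg1.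
have th01 : 0 < th <= 1 by rewrite th_gt0.
have below (x u : R) : 0 < u -> u < x -> x <= 1 -> 0 <= x <= 1.
  by move=> u0 ux x1; rewrite x1 (ltW (lt_trans u0 ux)).
have optg := optimal_AG_sell opt; have optm := optimal_AM_sell opt.
have optk := optimal_AG_keep opt; have optn := optimal_AN_keep opt.
have leG2 := sale_le I p2g S0; have leN2 := sale_le I p2n S0.
have gtG2 := @sale_gt _ I S p2g; have gtN2 := @sale_gt _ I S p2n.
have SgE : sale I S pg = pg + S.
  by rewrite /sale ifT// (le_trans Ip0)// ltW.
move: optg optm optk optn leG2 leN2 gtG2 gtN2.
set Sg := sale I S pg in SgE *; set G2 := sale I S p2g; set N2 := sale I S p2n.
set S1 := sale I S p1 => optg optm optk optn leG2 leN2 gtG2 gtN2.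
(* A type between [thg] and [Sg] never sells, yet would gain by selling to the government and
   keeping its second unit. *)
have Sg_thg : Sg <= thg.
  rewrite leNgt; apply/negP => lt1.
  have [x /andP[x1 x2] cx] := ae_itvoo_ex lt1 acts.
  have x01 : 0 <= x <= 1.
    apply: (below x _ (lt_le_trans th_gt0 th_thg) x1).
    by move: x2 SgE pgS; clear; lra.
  have [_ _ _ /(_ x1)[_ e]] := cx x01.
  have [|_] := optn x x01; first by rewrite e.
  by move: x2; clear; lra.
pose Wg := intcc 0 th (fun x => sigma AG true x * f x).
pose Wm := intcc 0 th (fun x => sigma AM true x * f x).
have meang : intcc 0 th (fun x => x * sigma AG true x * f x) = p2g * Wg.
  apply: (break_even_mean fi ug ug th01 _ be2g).
  by apply: filterS acts => x cx x01; split=> // xth; have [_ /(_ xth)[]] := cx x01.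
(* The market at [t = 1] and the non-recipient market at [t = 2] are supplied by the same types, so
   both prices are the mean of that group when it is not null. *)
have meanm1 : intcc 0 th (fun x => x * sigma AM true x * f x) = p1 * Wm.
  apply: (break_even_mean fi umA um th01 _ be1).
  apply: filterS acts => x cx x01; have [c1 c2 _ _] := cx x01; split=> xth.
    by have [_ _ -> _ _] := c1 xth; rewrite addr0.
  by have [_ -> -> _] := c2 xth; rewrite addr0.
have meanm : intcc 0 th (fun x => x * sigma AM true x * f x) = p2n * Wm.
  apply: (break_even_mean fi umT um th01 _ be2n).
  apply: filterS acts => x cx x01; have [c1 c2 _ _] := cx x01; split=> xth.
    by have [_ _ _ -> _] := c1 xth; rewrite addr0.
  by have [_ -> _ ->] := c2 xth; rewrite addr0.
have le01 (x : R) : 0 <= x <= th -> 0 <= x <= 1.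
  by move=> /andP[-> /le_trans->].
have [sumW sumX] : Wg + Wm = intcc 0 th f /\
    p2g * Wg + p2n * Wm = intcc 0 th (fun x => x * f x).
  rewrite -meang -meanm; apply: (group_decomposition fi ug um th1).
  apply: filterS acts => x cx xt; have [+ _ _ _] := cx (le01 x xt).
  by case/andP: xt => _ xt /(_ xt)[].
have H0 : 0 < intcc 0 th f by exact: intcc_density_gt0.
have p2g_th : 0 < Wg -> p2g < th.
  move=> W0; have := group_mean_lt f_gt0 fi ug th01 W0.
  by rewrite meang -/Wg (ltr_pM2r W0).
have p2n_th : 0 < Wm -> p2n < th.
  move=> W0; have := group_mean_lt f_gt0 fi um th01 W0.
  by rewrite meanm -/Wm (ltr_pM2r W0).
have S1N2 : 0 < Wm -> S1 = N2.
  move=> W0; congr sale; apply: (mulIf (lt0r_neq0 W0)).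
  by rewrite -meanm1 meanm.
have indiff : 0 < Wg -> 0 < Wm -> Sg + G2 = S1 + N2.
  move=> Wg0 Wm0; have [x x01 rx] := group_inhabited ug th1 Wg0.
  have [y y01 ry] := group_inhabited um th1 Wm0.
  by apply/le_anti; have [_ -> _] := optg x x01 rx; have [_ -> _] := optm y y01 ry.
have [Wg0 Wm0] : 0 <= Wg /\ 0 <= Wm by split; exact: (group_ge0 f_gt0).
have Wg_or : Wg = 0 \/ 0 < Wg.
  by have [|W] := eqVneq Wg 0; [left|right; rewrite lt0r W].
have Wm_or : Wm = 0 \/ 0 < Wm.
  by have [|W] := eqVneq Wm 0; [left|right; rewrite lt0r W].
(* Types just below [th], chosen off the null sets: an action of positive probability at such a type
   belongs to a group of positive mass. *)
have near_th (c : R) : c < th -> exists2 x, c < x < th &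
    [/\ 0 <= x <= 1, sigma AG true x + sigma AM true x = 1,
      Wg = 0 -> sigma AG true x = 0 & Wm = 0 -> sigma AM true x = 0].
  move=> cth; have mth : Num.max 0 c < th by rewrite gt_max th_gt0.
  have nullg : {ae leb R, forall x : measurableTypeR R, Wg = 0 ->
      0 <= x <= th -> sigma AG true x = 0}.
    have [W|W] := eqVneq Wg 0; last by apply: aeW => x /eqP; rewrite (negbTE W).
    by apply: filterS (group_null f_gt0 fi ug th1 W) => x ? _.
  have nullm : {ae leb R, forall x : measurableTypeR R, Wm = 0 ->
      0 <= x <= th -> sigma AM true x = 0}.
    have [W|W] := eqVneq Wm 0; last by apply: aeW => x /eqP; rewrite (negbTE W).
    by apply: filterS (group_null f_gt0 fi um th1 W) => x ? _.
  have [x /andP[+ xth]] := ae_itvoo_ex mth (filterI acts (filterI nullg nullm)).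
  rewrite gt_max => /andP[x0 cx] [ax [gx mx]].
  have x0th : 0 <= x <= th by rewrite (ltW x0) ltW.
  exists x; first by rewrite cx.
  have [/(_ (ltW xth))[]] := ax (le01 x x0th).
  split=> //; [exact: le01|by move=> /gx; exact|by move=> /mx; exact].
(* A type near [th] that uses the market could instead sell to the government and keep its second
   unit; by indifference between the groups, this deviation too is unprofitable only if the type is
   at most [G2]. *)
have th_G2 : 0 < Wg -> th <= G2.
  move=> W0; rewrite leNgt; apply/negP => /near_th[x /andP[G2x xth] [x01 r1 _ mx]].
  have [rx|rx] := ltP 0 (sigma AG true x).
    by have [xG2 _ _] := optg x x01 rx; move: G2x; rewrite ltNge xG2.
  have rm : 0 < sigma AM true x by move: rx r1; clear; lra.
  have W1 : 0 < Wm.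
    by rewrite lt0r Wm0 andbT; apply/eqP => /mx e; move: rm; rewrite e ltxx.
  have [_ _] := optm x x01 rm.
  by move: (indiff W0 W1) G2x; clear; lra.
have th_N2 : 0 < Wm -> th <= N2.
  move=> W0; rewrite leNgt; apply/negP => /near_th[x /andP[N2x xth] [x01 r1 gx _]].
  have [rx|rx] := ltP 0 (sigma AM true x).
    by have [xN2 _ _] := optm x x01 rx; move: N2x; rewrite ltNge xN2.
  have rg : 0 < sigma AG true x by move: rx r1; clear; lra.
  have W1 : 0 < Wg.
    by rewrite lt0r Wg0 andbT; apply/eqP => /gx e; move: rg; rewrite e ltxx.
  have [_ _] := optg x x01 rg.
  by move: (indiff W1 W0) N2x; clear; lra.
have cexpE : cexp_le f th * (Wg + Wm) = p2g * Wg + p2n * Wm.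
  by rewrite /cexp_le sumW sumX divfK// gt_eqF.
(* Averaging [th <= price + S] over the two groups gives [th <= cexp_le f th + S], which fails to
   the right of [th0]. *)
have th_th0 : th <= th0.
  rewrite leNgt; apply/negP => lt0.
  have := cexp_le_lt_sub f_gt0 fi flc th0_gt0 eth0 uniq lt0 th1.
  have hg : 0 <= Wg * (p2g + S - th).
    case: Wg_or => [->|W]; first by rewrite mul0r.
    by apply: mulr_ge0 => //; move: (th_G2 W) leG2; clear; lra.
  have hm : 0 <= Wm * (p2n + S - th).
    case: Wm_or => [->|W]; first by rewrite mul0r.
    by apply: mulr_ge0 => //; move: (th_N2 W) leN2; clear; lra.
  rewrite -sumW in H0.
  by rewrite -(ltr_pM2r H0) cexpE; move: hg hm; clear; lra.
have th0_Sg : th0 < Sg by rewrite SgE; move: eth0 p0pg; clear; lra.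
have th_lt_thg : th < thg := le_lt_trans th_th0 (lt_le_trans th0_Sg Sg_thg).
have ne x : th < x < thg -> 0 <= x <= 1.
  by move=> /andP[thx xthg]; apply: (below x th) => //; rewrite (le_trans (ltW xthg)).
(* A type between [Sg] and [thg] sells only to the government, yet would prefer to keep both
   units. *)
have thgE : thg = Sg.
  apply/le_anti; rewrite Sg_thg andbT leNgt; apply/negP => lt1.
  have [x /andP[Sx xthg] ax] := ae_itvoo_ex lt1 acts.
  have thx : th < x := lt_trans (le_lt_trans th_th0 th0_Sg) Sx.
  have x01 : 0 <= x <= 1 by rewrite ne// thx.
  have [_ _ + _] := ax x01; rewrite thx (ltW xthg) => /(_ isT)[e _].
  have [|_] := optk x x01; first by rewrite e.
  by rewrite leNgt Sx.
have thg_lt1 : thg < 1 by rewrite thgE SgE; move: pgS; clear; lra.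
have G2_th : G2 <= th.
  rewrite leNgt; apply/negP => lt1.
  have lt2 : th < Num.min G2 thg by rewrite lt_min lt1.
  have [x /andP[thx + ax]] := ae_itvoo_ex lt2 acts.
  rewrite lt_min => /andP[xG2 xthg].
  have x01 : 0 <= x <= 1 by rewrite ne// thx.
  have [_ _ + _] := ax x01; rewrite thx (ltW xthg) => /(_ isT)[e _].
  have [|+ _] := optk x x01; first by rewrite e.
  by rewrite leNgt xG2.
have N2_thg : N2 <= thg.
  rewrite leNgt; apply/negP => lt1.
  have lt2 : thg < Num.min N2 1 by rewrite lt_min lt1.
  have [x /andP[thgx + ax]] := ae_itvoo_ex lt2 acts.
  rewrite lt_min => /andP[xN2 x1].
  have x01 : 0 <= x <= 1.
    by apply: (below x th) => //; [exact: lt_trans thgx|exact: ltW].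
  have [_ _ _ /(_ thgx)[_ e]] := ax x01.
  have [|+ _] := optn x x01; first by rewrite e.
  by rewrite leNgt xN2.
(* The bound [q] keeps the offer high enough to fund the project; [c - S / 2] keeps it within [S]
   below [c], and above [p] whenever [p] itself funds. *)
have lt_offer (p q c : R) : I <= q -> q < c -> sale I S p <= c ->
    exists p', [/\ I <= p', p < p', p' < c & c < p' + S].
  move=> Iq qc pc; exists (Num.max q (c - S / 2)).
  split; first by rewrite le_max Iq.
  - rewrite lt_max; have [Ip|pI] := leP I p; last by rewrite (lt_le_trans pI Iq).
    by apply/orP; right; move: pc S0; rewrite /sale Ip; clear; lra.
  - by rewrite gt_max qc; move: S0; clear; lra.
  - by rewrite -ltrBlDr lt_max; apply/orP; right; move: S0; clear; lra.
(* Were one of the two groups null, the period-2 buyers on the corresponding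
   side of the bailout would face only types above a cutoff, and could
   profitably offer a price just below it. *)
have [Wg1 Wm1] : 0 < Wg /\ 0 < Wm.
  case: Wg_or => Wg1.
    have W1 : 0 < Wm by move: H0; rewrite -sumW Wg1 add0r.
    (* The break-even price is below [th] while the sale is worth at least [th], so the project must
       be funded: [I <= p2n]. *)
    have [In _] := gtN2 (lt_le_trans (p2n_th W1) (th_N2 W1)).
    have [p [Ip pp pu up]] := lt_offer p2g p2n th In (p2n_th W1) G2_th.
    exfalso; move: (devg p pp); apply/negP; rewrite -ltNge.
    apply: (profitable_offer f_gt0 fi ugA S0 Ip pu up (ltW th_gt0) th_lt_thg thg1).
    have nullg := group_null f_gt0 fi ug th1 Wg1.
    apply: filterS (filterI acts nullg) => x [ax gx] x01.
    have [c1 c2 c3 _] := ax x01; split=> [xth|/andP[thx xthg]].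
      have [_ -> _ _ _] := c1 xth; rewrite gx ?addr0//.
      by case/andP: x01 => ->.
    by have [-> _ _ _] := c2 thx; have [|-> _] := c3; rewrite ?thx ?ltW ?add0r.
  split=> //; case: Wm_or => // Wm1.
  have [Ig _] := gtG2 (lt_le_trans (p2g_th Wg1) (th_G2 Wg1)).
  have [p [Ip pp pu up]] := lt_offer p2n p2g thg Ig
    (lt_trans (p2g_th Wg1) th_lt_thg) N2_thg.
  exfalso; move: (devn p pp); apply/negP; rewrite -ltNge.
  have thg_ge0 := ltW (lt_trans th_gt0 th_lt_thg).
  apply: (profitable_offer f_gt0 fi uN S0 Ip pu up thg_ge0 thg_lt1 (lexx 1)).
  have nullm := group_null f_gt0 fi um th1 Wm1.
  apply: filterS (filterI acts nullm) => x [ax mx] x01.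
  have [c1 c2 c3 c4] := ax x01; split=> [xthg|/andP[thgx x1]].
    have [xth|thx] := leP x th.
      have [_ _ -> -> ->] := c1 xth; rewrite mx ?addr0//.
      by case/andP: x01 => ->.
    have [_ -> -> ->] := c2 thx; have [|_ ->] := c3; rewrite ?thx ?addr0//.
  have [_ -> -> ->] := c2 (lt_trans th_lt_thg thgx).
  by have [_ ->] := c4 thgx; rewrite !add0r.
have avg_gE : avg_g f sigma th = p2g.
  by rewrite /avg_g meang mulfK// gt_eqF.
have avg_mE : avg_m f sigma th = p2n.
  by rewrite /avg_m meanm mulfK// gt_eqF.
have [_ G2E] := gtG2 (lt_le_trans (p2g_th Wg1) (th_G2 Wg1)).
have [_ N2E] := gtN2 (lt_le_trans (p2n_th Wm1) (th_N2 Wm1)).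
have thE : th = p2g + S by rewrite -G2E; apply/le_anti; rewrite G2_th th_G2.
(* All four sales fund the project, so the returns [S] cancel from the indifference condition. *)
have mid : pg + p2g = 2 * p2n.
  have := indiff Wg1 Wm1; rewrite (S1N2 Wm1) SgE G2E N2E; clear; lra.
have p2g_pg : p2g < pg.
  by move: th_lt_thg; rewrite thgE SgE thE; clear; lra.
(* At [th = th0] the overall mean would be [th - S = p2g], but it also averages in the market group,
   which has positive mass and a higher mean. *)
have th_lt_th0 : th < th0.
  rewrite lt_neqAle th_th0 andbT; apply/eqP => e.
  have : 0 < (p2n - p2g) * Wm.
    by rewrite mulr_gt0//; move: mid p2g_pg; clear; lra.
  by move: cexpE; rewrite e -eth0 -e thE addrK; clear; lra.
(* For (iii): [p2n < th] turns [mid] into [pg < 2 * th - p2g = th + S], which is below [th0 + S]. *)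
have p2n_lt := p2n_th Wm1.
rewrite avg_gE avg_mE -eth0 thgE SgE; rewrite SgE in th0_Sg.
by move: mid p2g_pg th_lt_th0 th0_Sg thE p2n_lt; clear; split; [split|split|]; lra.
Qed.
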